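(* Let $\mathbb{T}$ be a time scale and let $f, p:\mathbb{T}\rightarrow \mathbb{R}$. Let $t\in \mathbb{T}^{\kappa}$ and $\lambda\in\mathbb{R}$, $\lambda>0$. Then the following properties hold: (1) If $f$ is continuous at $t$ and $t$ is right-scattered, then $f$ is $\Delta_{p}^{\lambda}$-differentiable (structural differentiable) at $t$ with $$f^{\Delta_{p}^{\lambda}}(t)=\frac{f^{\lambda}(\sigma(t))-f^{\lambda}(t)}{p(\sigma(t))-p(t)}.$$ (2) If $t$ is right-dense, then $f$ is structural differentiable at $t$ if and only if the limit $$\lim_{s\rightarrow t}\frac{f^{\lambda}(t)-f^{\lambda}(s)}{p(t)-p(s)}$$ exists as a finite number. In this case, $$f^{\Delta_{p}^{\lambda}}(t)=\lim_{s\rightarrow t}\frac{f^{\lambda}(t)-f^{\lambda}(s)}{p(t)-p(s)}.$$ (3) If $f$ is structural differentiable at $t$, then $$f^{\lambda}(\sigma(t))=f^{\lambda}(t)+\bigl(p(\sigma(t))-p(t)\bigr)f^{\Delta_{p}^{\lambda}}(t).$$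
   Context: A time scale $\mathbb{T}$ is an arbitrary nonempty closed subset of $\mathbb{R}$. The forward jump operator $\sigma:\mathbb{T}\to\mathbb{T}$ is $\sigma(t)=\inf\{s\in\mathbb{T}:s>t\}$, and the backward jump operator $\rho:\mathbb{T}\to\mathbb{T}$ is $\rho(t)=\sup\{s\in\mathbb{T}:s<t\}$ (with the usual time-scale conventions $\inf\emptyset=\sup\mathbb{T}$ and $\sup\emptyset=\inf\mathbb{T}$). A point $t$ is right-scattered if $\sigma(t)>t$, left-scattered if $\rho(t)<t$, and right-dense if $t<\sup\mathbb{T}$ and $\sigma(t)=t$. If $\mathbb{T}$ has a left-scattered maximum $m$, then $\mathbb{T}^{\kappa}=\mathbb{T}\setminus\{m\}$; otherwise $\mathbb{T}^{\kappa}=\mathbb{T}$. Notation: $f^{\lambda}(t)$ means $(f(t))^{\lambda}$. (In general, for instance when $\lambda=\frac12$ and the function takes negative values, these powers, and hence the derivative below, are complex numbers.) Structural derivative: let $f,p:\mathbb{T}\to\mathbb{R}$, $t\in\mathbb{T}^{\kappa}$ and $\lambda>0$. The structural derivative $f^{\Delta_{p}^{\lambda}}(t)$ of $f$ at $t$ (associated with $\lambda$ and $p$) is the number, provided it exists, with the property that given any $\epsilon>0$ there is a neighborhood $U$ of $t$ (i.e., $U=(t-\delta,t+\delta)\cap\mathbb{T}$ for some $\delta>0$) such that $$\left|[f^{\lambda}(\sigma(t))-f^{\lambda}(s)]-f^{\Delta_{p}^{\lambda}}(t)[p(\sigma(t))-p(s)]\right|\leq\epsilon\left|p(\sigma(t))-p(s)\right|$$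 for all $s\in U$. When this number exists, $f$ is called structural differentiable (or $\Delta_{p}^{\lambda}$-differentiable) at $t$.
   Formalization: In (1), p is also assumed continuous at t (the claim fails otherwise) and p(σ(t)) ≠ p(t); in (2), p(s) ≠ p(t) is assumed for s ≠ t in the time scale near t, so that the quotients are defined. *)

(* Defs.v *)
From Stdlib Require Import Reals.
From Coquelicot Require Import Coquelicot.

Open Scope R_scope.

(** Classical reals of Stdlib, limits and complex numbers of Coquelicot.
    A time scale is a subset [T : R -> Prop]; a function on [T] is the
    restriction of a total function [R -> R], whose values outside [T]
    are never used. *)

Definition time_scale (T : R -> Prop) : Prop := (exists x, T x) /\ closed T.

(** The set under the infimum is bounded below by [t], so its infimum in [Rbar]
    is finite exactly when it is nonempty; the other branch is the convention
    inf(empty) = sup T. Dually for [backward_jump]. *)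
Definition forward_jump (T : R -> Prop) (t : R) : R :=
  match Glb_Rbar (fun s => T s /\ t < s) with
  | Finite x => x
  | _ => real (Lub_Rbar T)
  end.

Definition backward_jump (T : R -> Prop) (t : R) : R :=
  match Lub_Rbar (fun s => T s /\ s < t) with
  | Finite x => x
  | _ => real (Glb_Rbar T)
  end.

Definition right_scattered (T : R -> Prop) (t : R) : Prop := t < forward_jump T t.

Definition left_scattered (T : R -> Prop) (t : R) : Prop := backward_jump T t < t.

Definition right_dense (T : R -> Prop) (t : R) : Prop :=
  Rbar_lt t (Lub_Rbar T) /\ forward_jump T t = t.

Definition is_maximum (T : R -> Prop) (m : R) : Prop :=
  T m /\ forall s, T s -> s <= m.

Definition kappa (T : R -> Prop) (t : R) : Prop :=
  T t /\ ~ (is_maximum T t /\ left_scattered T t).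

Definition continuous_at (T : R -> Prop) (g : R -> R) (t : R) : Prop :=
  filterlim g (within T (locally t)) (locally (g t)).

(** Principal value of [x ^ lam] for real [x] and [lam > 0], i.e.
    exp(lam * Log x) with Log x = ln(-x) + i*PI for x < 0, and 0 ^ lam = 0. *)
Definition Cpower (x lam : R) : C :=
  if Rlt_dec 0 x then RtoC (Rpower x lam)
  else if Rlt_dec x 0 then
    (Rpower (- x) lam * cos (lam * PI), Rpower (- x) lam * sin (lam * PI))
  else RtoC 0.

(** [D] need not be unique in general: any [D] qualifies when, for instance,
    [f] and [p] are constant. *)
Definition is_struct_deriv (T : R -> Prop) (f p : R -> R) (lam t : R) (D : C)
  : Prop :=
  forall eps : R, 0 < eps ->
  exists delta : R, 0 < delta /\
  forall s : R, T s -> t - delta < s < t + delta ->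
    Cmod ((Cpower (f (forward_jump T t)) lam - Cpower (f s) lam)
          - D * RtoC (p (forward_jump T t) - p s))%C
    <= eps * Rabs (p (forward_jump T t) - p s).

Definition struct_differentiable (T : R -> Prop) (f p : R -> R) (lam t : R)
  : Prop :=
  exists D : C, is_struct_deriv T f p lam t D.

(** [lim_(s -> t) q s = L], with [s] ranging over [T] minus the point [t]. *)
Definition is_limit_at (T : R -> Prop) (q : R -> C) (t : R) (L : C) : Prop :=
  filterlim q (within (fun s => T s /\ s <> t) (locally t)) (locally L).

(* Main.v *)
(** Taking [s = t] in the definition of the structural derivative bounds the
    defect in (3) by every multiple of [|p (sigma t) - p t|], so it vanishes.
    At points where [p s <> p (sigma t)] the defining inequality can be divided
    by [|p (sigma t) - p s|], which turns it into convergence of the difference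
    quotient. At a right-scattered point that quotient is continuous in [s],
    since the principal power is continuous on the real line when [lam > 0]:
    its jump across the branch cut is invisible along the real axis. *)

Require Import Defs.
From Stdlib Require Import Reals Lra.
From Coquelicot Require Import Coquelicot.

Open Scope R_scope.

(** The power of the positive part of [x]. The test on the sign matters: [Rpower] takes the value 1
    at nonpositive bases. *)
Definition pos_power (lam x : R) : R :=
  if Rlt_dec 0 x then Rpower x lam else 0.

Lemma continuous_pos_power (lam x : R) :
  0 < lam -> continuous (pos_power lam) x.
Proof.
intros hlam; destruct (Rtotal_order x 0) as [hx | [-> | hx]].
- apply (continuous_ext_loc _ (fun _ => 0)); [| apply continuous_const].
  apply (filter_imp (fun y => y < 0)); [| now apply open_lt].
  intros y hy; unfold pos_power; destruct (Rlt_dec 0 y); lra.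
- apply filterlim_locally; intros eps.
  (* The radius solves [d ^ lam = eps], so monotonicity of the power bounds it by [eps] on
     [0 < y < d]. *)
  assert (hd : 0 < Rpower eps (/ lam)) by apply exp_pos.
  exists (mkposreal _ hd); intros y hy.
  assert (heps := cond_pos eps).
  change (Rabs (y - 0) < Rpower eps (/ lam)) in hy.
  change (Rabs (pos_power lam y - pos_power lam 0) < eps).
  rewrite Rminus_0_r in hy; apply Rabs_def2 in hy.
  unfold pos_power; destruct (Rlt_dec 0 0); [lra |].
  destruct (Rlt_dec 0 y) as [hy0 |];
    [| now rewrite Rminus_0_r, Rabs_R0].
  rewrite Rminus_0_r, Rabs_pos_eq by (left; apply exp_pos).
  replace (pos eps) with (Rpower (Rpower eps (/ lam)) lam)
    by (rewrite Rpower_mult, Rinv_l, Rpower_1; lra).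
  apply Rlt_Rpower_l; lra.
- apply (continuous_ext_loc _ (fun y => exp (lam * ln y))).
  + apply (filter_imp (fun y => 0 < y)); [| now apply open_gt].
    intros y hy; unfold pos_power, Rpower; destruct (Rlt_dec 0 y); lra.
  + apply continuous_exp_comp.
    apply (continuous_mult (K := R_AbsRing) (fun _ => lam) ln x);
      [apply continuous_const | now apply continuous_ln].
Qed.

(** At most one of the two terms is nonzero. The argument of the power is constant on each
    half-line, so continuity on the real axis reduces to that of the real function [pos_power]. *)
Lemma Cpower_pos_power (lam x : R) :
  Cpower x lam =
  (RtoC (pos_power lam x)
   + RtoC (pos_power lam (- x)) * (cos (lam * PI), sin (lam * PI)))%C.
Proof.
unfold Cpower, pos_power.
destruct (Rlt_dec 0 x), (Rlt_dec x 0), (Rlt_dec 0 (- x)); try lra;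
  apply injective_projections; simpl; ring.
Qed.

Lemma continuous_Cpower (lam x : R) :
  0 < lam -> filterlim (fun y => Cpower y lam) (locally x) (locally (Cpower x lam)).
Proof.
intros hlam.
set (V := prod_NormedModule R_AbsRing R_NormedModule R_NormedModule).
set (w := (cos (lam * PI), sin (lam * PI)) : V).
set (g := fun y : R =>
  plus (scal (pos_power lam y) ((1, 0) : V)) (scal (pos_power lam (- y)) w) : V).
assert (hg : forall y, g y = Cpower y lam).
{ intros y; rewrite Cpower_pos_power.
  apply injective_projections; simpl; unfold plus, scal; simpl;
    unfold mult; simpl; ring. }
rewrite <- hg; apply (filterlim_ext _ _ hg).
apply (continuous_plus (V := V)); apply (continuous_scal_l (V := V)).
- now apply continuous_pos_power.
- apply (continuous_comp Ropp (pos_power lam)).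
  + apply (continuous_opp (V := R_NormedModule)), continuous_id.
  + now apply continuous_pos_power.
Qed.

(** Neighborhoods in [C] come from the product structure on pairs, while the structural derivative
    is phrased with the modulus; the two are equivalent. *)
Lemma filterlim_C_Cmod {S : Type} {F : (S -> Prop) -> Prop} {FF : Filter F}
  (q : S -> C) (L : C) :
  filterlim q F (locally L) <->
  forall eps : R, 0 < eps -> F (fun s => Cmod (q s - L)%C < eps).
Proof.
assert (h := filterlim_locally_ball_norm (K := C_AbsRing)
  (U := C_NormedModule) (F := F) q L).
split.
- intros hq eps heps; exact (proj1 h hq (mkposreal eps heps)).
- intros hq; apply h; intros eps; exact (hq eps (cond_pos eps)).
Qed.

(** If some punctured neighborhood of [t] missed [T], the points of [T] beyond [t] would keep a
    distance [d]: either their infimum exceeds [t], or there are none and [t] bounds [T] above. This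
    properness makes limits at [t] unique. *)
Lemma right_dense_proper (T : R -> Prop) (t : R) :
  right_dense T t ->
  ProperFilter' (within (fun s => T s /\ s <> t) (locally t)).
Proof.
intros [hlub hsig]; split; [| apply within_filter, locally_filter].
intros [d hd].
assert (hd0 := cond_pos d).
assert (hgap : forall s, T s -> t < s -> t + d <= s).
{ intros s hs hts; destruct (Rle_lt_dec (t + d) s) as [| hlt]; [easy | exfalso].
  apply (hd s); [| split; [easy | lra]].
  change (Rabs (s - t) < d); apply Rabs_def1; lra. }
unfold forward_jump in hsig.
destruct (Glb_Rbar_correct (fun s => T s /\ t < s)) as [hlb hglb].
destruct (Glb_Rbar (fun s => T s /\ t < s)) as [g | |].
- assert (hle : Rbar_le (t + d) g).
  { apply hglb; intros s [hs hts]; now apply hgap. }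
  simpl in hle; lra.
- apply Rbar_lt_not_le in hlub; apply hlub.
  apply Lub_Rbar_correct; intros s hs; simpl.
  destruct (Rle_lt_dec s t) as [| hts]; [easy |].
  destruct (hlb s (conj hs hts)).
- destruct (hglb t); intros s [_ hts]; simpl; lra.
Qed.

Lemma struct_deriv_jump (T : R -> Prop) (f p : R -> R) (lam t : R) (D : C) :
  T t -> is_struct_deriv T f p lam t D ->
  (Cpower (f (forward_jump T t)) lam - Cpower (f t) lam
   = D * RtoC (p (forward_jump T t) - p t))%C.
Proof.
intros ht hD.
set (x := (Cpower (f (forward_jump T t)) lam - Cpower (f t) lam)%C).
set (a := p (forward_jump T t) - p t).
assert (hx : Cmod (x - D * RtoC a)%C <= 0).
{ apply le_epsilon; intros eps heps; rewrite Rplus_0_l.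
  assert (ha := Rabs_pos a).
  (* Adding 1 keeps the denominator positive when [a = 0], and [|a| / (|a| + 1) <= 1]. *)
  destruct (hD (eps / (Rabs a + 1))) as [d [hd hs]].
  { apply Rdiv_lt_0_compat; lra. }
  apply Rle_trans with (1 := hs t ht ltac:(lra)).
  fold a; unfold Rdiv; rewrite Rmult_assoc.
  rewrite <- (Rmult_1_r eps) at 2; apply Rmult_le_compat_l; [lra |].
  rewrite Rmult_comm; apply (Rmult_le_reg_r (Rabs a + 1)); [lra |].
  rewrite Rmult_assoc, Rinv_l; lra. }
assert (h0 : (x - D * RtoC a = 0)%C).
{ apply Cmod_eq_0, Rle_antisym; [exact hx | apply Cmod_ge_0]. }
replace x with ((x - D * RtoC a) + D * RtoC a)%C by ring.
rewrite h0; ring.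
Qed.

(** The set [A] is [T] itself when [t] is right-scattered, and [T] minus the
    point [t] when [t] is right-dense. *)
Lemma is_struct_deriv_limit (T A : R -> Prop) (f p : R -> R) (lam t : R) (D : C) :
  (forall s, A s -> T s) ->
  (forall s, T s -> A s \/ s = forward_jump T t) ->
  within A (locally t) (fun s => p s <> p (forward_jump T t)) ->
  is_struct_deriv T f p lam t D <->
  filterlim (fun s => ((Cpower (f (forward_jump T t)) lam - Cpower (f s) lam)
                       / RtoC (p (forward_jump T t) - p s))%C)
    (within A (locally t)) (locally D).
Proof.
set (sig := forward_jump T t); intros hAT hTA hp.
assert (hquot : forall s, p s <> p sig ->
  Cmod ((Cpower (f sig) lam - Cpower (f s) lam) - D * RtoC (p sig - p s))%C
  = Cmod ((Cpower (f sig) lam - Cpower (f s) lam) / RtoC (p sig - p s) - D)%C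
    * Rabs (p sig - p s)).
{ intros s hs; rewrite <- Cmod_R, <- Cmod_mult; f_equal.
  field; intros h; apply RtoC_inj in h; lra. }
rewrite filterlim_C_Cmod; split.
- intros hD eps heps.
  (* Halving turns the non-strict bound of the derivative into the strict one of the limit. *)
  destruct (hD (eps / 2) ltac:(lra)) as [d [hd hs]].
  apply (filter_imp (F := locally t) (fun s => (A s -> p s <> p sig) /\ Rabs (s - t) < d));
    [| apply (filter_and (F := locally t)); [exact hp | now exists (mkposreal d hd)]].
  intros s [hps hst] hAs; specialize (hps hAs); apply Rabs_def2 in hst.
  specialize (hs s (hAT s hAs) ltac:(lra)); fold sig in hs.
  rewrite hquot in hs by easy.
  apply Rmult_le_reg_r in hs; [lra | apply Rabs_pos_lt; lra].
- intros hq eps heps.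
  destruct (filter_and (F := locally t) _ _ hp (hq eps heps)) as [d hd].
  exists d; split; [apply cond_pos |]; intros s hTs hst; fold sig.
  destruct (hTA s hTs) as [hAs | ->].
  + destruct (hd s) as [hps hlt].
    { change (Rabs (s - t) < d); apply Rabs_def1; lra. }
    rewrite hquot by auto.
    apply Rmult_le_compat_r; [apply Rabs_pos | now left; apply hlt].
  (* At [s = sig] both sides of the defining inequality vanish, so a set [A] without this point
     loses nothing. *)
  + fold sig; rewrite Rminus_diag.
    replace (_ - _)%C with (RtoC 0) by ring.
    rewrite Cmod_0, Rabs_R0; lra.
Qed.

(** The conditions on [p] in (1) and (2) make the denominators nonzero near [t], so that the
    quotients are genuine and not the default value of a division by zero. *)
Theorem theorem3 (T : R -> Prop) (f p : R -> R) (t lam : R)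
  (hT : time_scale T) (ht : kappa T t) (hlam : 0 < lam) :
  (continuous_at T f t -> right_scattered T t ->
   continuous_at T p t -> p (forward_jump T t) <> p t ->
     struct_differentiable T f p lam t /\
     forall D : C, is_struct_deriv T f p lam t D ->
       D = ((Cpower (f (forward_jump T t)) lam - Cpower (f t) lam)
            / RtoC (p (forward_jump T t) - p t))%C)
  /\
  (right_dense T t ->
   (exists delta : R, 0 < delta /\
      forall s : R, T s -> s <> t -> t - delta < s < t + delta -> p s <> p t) ->
     (struct_differentiable T f p lam t <->
      exists L : C,
        is_limit_at T (fun s => ((Cpower (f t) lam - Cpower (f s) lam)
                                 / RtoC (p t - p s))%C) t L)
     /\
     forall D L : C,
       is_struct_deriv T f p lam t D ->
       is_limit_at T (fun s => ((Cpower (f t) lam - Cpower (f s) lam)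
                                / RtoC (p t - p s))%C) t L ->
       D = L)
  /\
  (forall D : C, is_struct_deriv T f p lam t D ->
     Cpower (f (forward_jump T t)) lam
     = (Cpower (f t) lam + RtoC (p (forward_jump T t) - p t) * D)%C).
Proof.
destruct ht as [htT _].
assert (hjump := struct_deriv_jump T f p lam t).
split; [| split].
- intros hf _ hp hne.
  set (sig := forward_jump T t) in *.
  assert (hne0 : RtoC (p sig - p t) <> 0%C).
  { intros h; apply RtoC_inj in h; lra. }
  split.
  + exists ((Cpower (f sig) lam - Cpower (f t) lam) / RtoC (p sig - p t))%C.
    apply (is_struct_deriv_limit T T); [easy | now left | |].
    * apply (hp (fun y => y <> p sig)), open_neq; fold sig; auto.
    * fold sig.
      set (V := prod_NormedModule R_AbsRing R_NormedModule R_NormedModule).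
      (* Also valid at [p sig = u]: both the real and the complex inverse of
         [0] are [0]. *)
      assert (hquot : forall u v : R,
        scal (/ (p sig - u)) (minus (Cpower (f sig) lam : V) (Cpower v lam))
        = ((Cpower (f sig) lam - Cpower v lam) / RtoC (p sig - u))%C).
      { intros u v; unfold Cdiv.
        replace (/ RtoC (p sig - u))%C with (RtoC (/ (p sig - u)));
          [| destruct (Req_dec (p sig - u) 0) as [h | h];
             [rewrite h, Rinv_0; apply injective_projections; simpl; unfold Rdiv; ring
             | now apply RtoC_inv]].
        apply injective_projections; unfold scal, minus, plus, opp; simpl;
          unfold scal, plus, opp, mult; simpl; unfold mult; simpl; ring. }
      rewrite <- hquot.
      apply (filterlim_ext _ _ (fun s => hquot (p s) (f s))).
      (* The quotient is a real scalar times a vector of the plane, each converging along [T] by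
         continuity of [p] and of [f]. *)
      apply (filterlim_comp_2 (fun s => / (p sig - p s))
        (fun s => minus (Cpower (f sig) lam : V) (Cpower (f s) lam)) scal
        (G := locally (/ (p sig - p t)))
        (H := locally (minus (Cpower (f sig) lam : V) (Cpower (f t) lam)))).
      -- apply (filterlim_comp _ _ _ p (fun u => / (p sig - u)) _ (locally (p t)));
           [exact hp |].
         apply (continuous_Rinv_comp (fun u => p sig - u)); [| lra].
         apply (continuous_minus (V := R_NormedModule));
           [apply continuous_const | apply continuous_id].
      -- apply (filterlim_comp _ _ _ f
           (fun v => minus (Cpower (f sig) lam : V) (Cpower v lam)) _
           (locally (f t))); [exact hf |].
         apply (continuous_minus (V := V) (fun _ => Cpower (f sig) lam)
           (fun v => Cpower v lam) (f t));
           [apply continuous_const | now apply continuous_Cpower].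
      -- apply (filterlim_scal (V := V)).
  + intros D hD; rewrite (hjump D htT hD); field; exact hne0.
- intros hrd [d [hd hp]].
  assert (hsig := proj2 hrd).
  assert (hlim : forall D, is_struct_deriv T f p lam t D <->
    is_limit_at T (fun s => ((Cpower (f t) lam - Cpower (f s) lam)
                             / RtoC (p t - p s))%C) t D).
  { intros D; unfold is_limit_at.
    rewrite (is_struct_deriv_limit T (fun s => T s /\ s <> t)); rewrite ?hsig.
    - reflexivity.
    - easy.
    - intros s hs; destruct (Req_dec s t); auto.
    - exists (mkposreal d hd); intros s hst [hs hne]; apply hp; try easy.
      apply Rabs_def2 in hst; simpl in hst; unfold minus, plus, opp in hst;
        simpl in hst; lra. }
  split.
  + split; intros [D hD]; exists D; now apply hlim.
  + intros D L hD hL; apply hlim in hD.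
    (* Here the jump identity reads [0 = 0] and does not determine [D]; uniqueness comes from the
       limit. *)
    exact (@filterlim_locally_unique R C_AbsRing C_NormedModule _
      (right_dense_proper T t hrd) _ D L hD hL).
- intros D hD; specialize (hjump D htT hD).
  replace (Cpower (f (forward_jump T t)) lam) with
    (Cpower (f t) lam + (Cpower (f (forward_jump T t)) lam - Cpower (f t) lam))%C
    by ring.
  rewrite hjump; ring.
Qed.
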